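(* For all $a>0$ there exists a unique $t_0\in(0,\pi/2)$ such that, for $b=\left(\sin^2(t_0)+2a\sin(t_0)\cos(t_0)\right)^{1/2}$, the nodary $N^+(a,b)=(g^+_{\mathrm n},f^+_{\mathrm n})$ restricted to the interval $(-t_0,t_0)$ lies inside the unit ball (that is, $g^+_{\mathrm n}(s)^2+f^+_{\mathrm n}(s)^2\le 1$ for all $s\in(-t_0,t_0)$) and meets the unit sphere orthogonally at $t_0$.
   Context: For $a,b>0$ the nodary $N^+(a,b)=(g^+_{\mathrm n},f^+_{\mathrm n})$ is the plane curve $$g^+_{\mathrm n}(s)=-a^2b^2\int_0^s\frac{\sin^2x}{(b^2+a^2\cos^2x)^{3/2}}\,dx-\frac{a^2\sin s\cos s}{\sqrt{b^2+a^2\cos^2s}}+a\sin s,\qquad f^+_{\mathrm n}(s)=\sqrt{b^2+a^2\cos^2s}-a\cos s,\qquad s\in\mathbb R,$$ which is symmetric with respect to the $y$-axis. It is the profile curve of a surface of revolution about the $g$-axis with constant mean curvature $-\frac{1}{2a}$. A profile curve $(g,f)$ meets the unit sphere (equivalently, in the plane of the profile curve, the unit circle) orthogonally at $t>0$ if $g(t)^2+f(t)^2=1$ and $g'(t)f(t)-g(t)f'(t)=0$. *)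

(* Defs.v *)
From Stdlib Require Import Reals.
From Coquelicot Require Import Coquelicot.
Open Scope R_scope.

(* The radicand is positive for b > 0, so [Rpower] is the genuine 3/2-power
   and the integrand is continuous on R. *)
Definition nodary_g (a b s : R) : R :=
  - a ^ 2 * b ^ 2 *
      RInt (fun x => sin x ^ 2 / Rpower (b ^ 2 + a ^ 2 * cos x ^ 2) (3 / 2)) 0 s
  - a ^ 2 * sin s * cos s / sqrt (b ^ 2 + a ^ 2 * cos s ^ 2)
  + a * sin s.

Definition nodary_f (a b s : R) : R :=
  sqrt (b ^ 2 + a ^ 2 * cos s ^ 2) - a * cos s.

(* [Derive] is total; the notion is meant for differentiable profile curves,
   such as the nodary with a, b > 0. *)
Definition meets_unit_sphere_orthogonally (g f : R -> R) (t : R) : Prop :=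
  0 < t /\
  g t ^ 2 + f t ^ 2 = 1 /\
  Derive g t * f t - g t * Derive f t = 0.

Definition inside_unit_ball_on (g f : R -> R) (u v : R) : Prop :=
  forall s : R, u < s < v -> g s ^ 2 + f s ^ 2 <= 1.

(* Main.v *)
Require Import Defs.
From Stdlib Require Import Reals Ranalysis5 Lra Psatz.
From Coquelicot Require Import Coquelicot.
Open Scope R_scope.

(* Writing D = sqrt (b^2 + a^2 cos^2), the profile curve satisfies
   g' = (a f / D) cos and f' = (a f / D) sin, so s is its tangent angle.  For
   b = b(t) one has f(t) = sin t, hence the curve meets the circle orthogonally
   at t exactly when g(t) = cos t; it then stays inside because g^2 + f^2
   increases on [0, pi/2] and is even.  The equation g(t) = cos t has a root by
   the intermediate value theorem, g being Lipschitz in b.  The root is unique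
   because g increases with b while g / b^2 decreases with b: one of the two
   monotonicities applies to any pair of roots, according to how b(t) compares
   at them. *)

(** * The radicand, its root and the sign of f *)

Definition nodary_root (a b s : R) : R := sqrt (b ^ 2 + a ^ 2 * cos s ^ 2).

Definition nodary_b (a t : R) : R := sqrt (sin t ^ 2 + 2 * a * sin t * cos t).

Lemma radicand_pos (a b s : R) : 0 < b -> 0 < b ^ 2 + a ^ 2 * cos s ^ 2.
Proof.
  intros Hb.
  assert (0 < b ^ 2) by (apply pow_lt; exact Hb).
  assert (0 <= (a * cos s) ^ 2) by apply pow2_ge_0.
  nra.
Qed.

Lemma nodary_root_pos (a b s : R) : 0 < b -> 0 < nodary_root a b s.
Proof. intros Hb; apply sqrt_lt_R0, radicand_pos, Hb. Qed.

Lemma nodary_root_sqr (a b s : R) :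
  0 < b -> nodary_root a b s ^ 2 = b ^ 2 + a ^ 2 * cos s ^ 2.
Proof.
  intros Hb; apply pow2_sqrt, Rlt_le, radicand_pos, Hb.
Qed.

(** The absolute value covers both signs of cos; positivity of f on the whole line follows. *)
Lemma nodary_root_gt (a b s : R) :
  0 < b -> Rabs (a * cos s) < nodary_root a b s.
Proof.
  intros Hb.
  rewrite <- sqrt_Rsqr_abs.
  apply sqrt_lt_1_alt; split; [apply Rle_0_sqr|].
  unfold Rsqr; nra.
Qed.

Lemma nodary_f_pos (a b s : R) : 0 < b -> 0 < nodary_f a b s.
Proof.
  intros Hb.
  generalize (nodary_root_gt a b s Hb) (Rle_abs (a * cos s)).
  unfold nodary_f, nodary_root; lra.
Qed.

Lemma Rpower_3_2 (x : R) : 0 < x -> Rpower x (3 / 2) = x * sqrt x.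
Proof.
  intros Hx.
  replace (3 / 2) with (1 + / 2) by field.
  rewrite Rpower_plus, Rpower_1, Rpower_sqrt by exact Hx; reflexivity.
Qed.

(** * Derivatives of the profile curve *)

Lemma is_derive_nodary_f (a b s : R) : 0 < b ->
  is_derive (nodary_f a b) s (a * sin s * nodary_f a b s / nodary_root a b s).
Proof.
  intros Hb.
  pose proof (radicand_pos a b s Hb) as Hr.
  pose proof (nodary_root_pos a b s Hb) as HD.
  unfold nodary_f; auto_derive; [lra|].
  unfold nodary_root in *.
  replace (b * (b * 1) + a * (a * 1) * (cos s * (cos s * 1)))
    with (b ^ 2 + a ^ 2 * cos s ^ 2) by ring.
  field; lra.
Qed.

(** The integral contributes its integrand. Since b^2 + a^2 cos^2 = D^2, the sin^2 terms cancel and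
    a cos - a^2 cos^2 / D remains. *)
Lemma is_derive_nodary_g (a b s : R) : 0 < b ->
  is_derive (nodary_g a b) s (a * cos s * nodary_f a b s / nodary_root a b s).
Proof.
  intros Hb.
  assert (Hc : forall x, continuous
    (fun x => sin x ^ 2 / Rpower (b ^ 2 + a ^ 2 * cos x ^ 2) (3 / 2)) x).
  { intros x.
    pose proof (radicand_pos a b x Hb) as Hr.
    apply (ex_derive_continuous (V := R_NormedModule)).
    unfold Rpower; auto_derive; split; [simpl in Hr; lra|].
    split; [|exact I]. apply Rgt_not_eq, exp_pos. }
  pose proof (radicand_pos a b s Hb) as Hr.
  pose proof (nodary_root_pos a b s Hb) as HD.
  pose proof (nodary_root_sqr a b s Hb) as HD2.
  assert (Hi := is_derive_RInt _
    (fun x => RInt (fun x => sin x ^ 2 / Rpower (b ^ 2 + a ^ 2 * cos x ^ 2) (3 / 2)) 0 x)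
    0 s (filter_forall _ (fun x => RInt_correct (V := R_CompleteNormedModule) _ 0 x
      (ex_RInt_continuous (V := R_CompleteNormedModule) _ 0 x (fun z _ => Hc z))))
    (Hc s)).
  cbv beta in Hi; rewrite (Rpower_3_2 _ Hr) in Hi.
  unfold nodary_g.
  (* Naming the integral makes [auto_derive] treat it as an abstract function, whose derivative [Hi]
     supplies. *)
  set (I := fun x => RInt _ 0 x) in Hi.
  change (is_derive (fun s => - a ^ 2 * b ^ 2 * I s
    - a ^ 2 * sin s * cos s / sqrt (b ^ 2 + a ^ 2 * cos s ^ 2) + a * sin s) s
    (a * cos s * nodary_f a b s / nodary_root a b s)).
  auto_derive.
  { split; [eexists; exact Hi|].
    repeat split; [lra|].
    apply Rgt_not_eq, sqrt_lt_R0; lra. }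
  replace (Derive _ s) with (Derive I s) by reflexivity.
  rewrite (is_derive_unique _ _ _ Hi).
  unfold nodary_f.
  replace (b * (b * 1) + a * (a * 1) * (cos s * (cos s * 1)))
    with (b ^ 2 + a ^ 2 * cos s ^ 2) by ring.
  fold (nodary_root a b s).
  rewrite <- HD2.
  set (D := nodary_root a b s) in *.
  (* Eliminating b^2 in favour of D turns the goal into a rational identity. *)
  replace (b * (b * 1)) with (D ^ 2 - a ^ 2 * cos s ^ 2) by (rewrite HD2; ring).
  field; lra.
Qed.

(** Eta-expanded, like its companion for g, to match the goals that [auto_derive] leaves. *)
Lemma Derive_nodary_f (a b s : R) : 0 < b ->
  Derive (fun x => nodary_f a b x) s
  = a * sin s * nodary_f a b s / nodary_root a b s.
Proof. intros Hb; apply is_derive_unique, is_derive_nodary_f, Hb. Qed.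

Lemma Derive_nodary_g (a b s : R) : 0 < b ->
  Derive (fun x => nodary_g a b x) s
  = a * cos s * nodary_f a b s / nodary_root a b s.
Proof. intros Hb; apply is_derive_unique, is_derive_nodary_g, Hb. Qed.

Lemma nodary_g_0 (a b : R) : nodary_g a b 0 = 0.
Proof.
  unfold nodary_g; rewrite RInt_point, sin_0.
  change (zero : R) with 0; unfold Rdiv; ring.
Qed.

(** * Comparison by derivatives, and the symmetry of the curve *)

Lemma is_derive_le (F dF : R -> R) (u v : R) : u <= v ->
  (forall x, u <= x <= v -> is_derive F x (dF x)) ->
  (forall x, u <= x <= v -> 0 <= dF x) -> F u <= F v.
Proof.
  intros Huv HF HdF.
  destruct (Req_dec u v) as [->|Hne]; [lra|].
  destruct (MVT_cor2 F dF u v) as [c [Hc Hcuv]]; [lra| |].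
  - intros x Hx; apply is_derive_Reals, HF, Hx.
  - assert (0 <= dF c) by (apply HdF; lra). nra.
Qed.

Lemma is_derive_0_eq (F : R -> R) (u v : R) :
  (forall x, is_derive F x 0) -> F u = F v.
Proof.
  intros HF.
  assert (H : forall u v, u <= v -> F u = F v).
  { clear u v; intros u v Huv; apply Rle_antisym.
    - apply (is_derive_le F (fun _ => 0)); intros; auto; lra.
    - apply Ropp_le_cancel.
      apply (is_derive_le (fun x => - F x) (fun _ => 0)); intros; auto; try lra.
      rewrite <- Ropp_0; apply (is_derive_opp F), HF. }
  destruct (Rle_dec u v); [apply H; lra|symmetry; apply H; lra].
Qed.

Lemma nodary_f_opp (a b s : R) : nodary_f a b (- s) = nodary_f a b s.
Proof. unfold nodary_f; rewrite cos_neg; reflexivity. Qed.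

Lemma nodary_root_opp (a b s : R) : nodary_root a b (- s) = nodary_root a b s.
Proof. unfold nodary_root; rewrite cos_neg; reflexivity. Qed.

(** As g' is even, g(s) + g(-s) has zero derivative, and it vanishes at 0. *)
Lemma nodary_g_opp (a b s : R) : 0 < b -> nodary_g a b (- s) = - nodary_g a b s.
Proof.
  intros Hb.
  enough (nodary_g a b s + nodary_g a b (- s) = 0) by lra.
  transitivity (nodary_g a b 0 + nodary_g a b (- 0)).
  2: rewrite Ropp_0, nodary_g_0; ring.
  apply (is_derive_0_eq (fun s => nodary_g a b s + nodary_g a b (- s))).
  intros x.
  pose proof (is_derive_nodary_g a b x Hb) as H1.
  pose proof (is_derive_nodary_g a b (- x) Hb) as H2.
  auto_derive; [repeat split; eexists; eassumption|].
  rewrite !Derive_nodary_g, nodary_f_opp, nodary_root_opp, cos_neg by exact Hb.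
  ring.
Qed.

(** * Monotonicity along the curve *)

Lemma cos_nonneg (x s : R) : 0 <= x <= s -> s <= PI / 2 -> 0 <= cos x.
Proof. intros Hx Hs; apply cos_ge_0; lra. Qed.

Lemma sin_nonneg (x s : R) : 0 <= x <= s -> s <= PI / 2 -> 0 <= sin x.
Proof. intros Hx Hs; apply sin_ge_0; lra. Qed.

(** This common factor of g' and f' is the speed of the curve, (cos, sin) being a unit vector. *)
Lemma nodary_speed_nonneg (a b x : R) : 0 < a -> 0 < b ->
  0 <= a * nodary_f a b x / nodary_root a b x.
Proof.
  intros Ha Hb.
  pose proof (nodary_f_pos a b x Hb).
  apply Rlt_le, Rdiv_lt_0_compat; [nra|apply nodary_root_pos, Hb].
Qed.

Lemma nodary_g_incr (a b u v : R) : 0 < a -> 0 < b ->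
  0 <= u -> u <= v -> v <= PI / 2 -> nodary_g a b u <= nodary_g a b v.
Proof.
  intros Ha Hb Hu Huv Hv.
  eapply is_derive_le; [exact Huv|intros; apply is_derive_nodary_g, Hb|].
  intros x Hx; cbv beta.
  replace (_ / _) with (cos x * (a * nodary_f a b x / nodary_root a b x))
    by (unfold Rdiv; ring).
  apply Rmult_le_pos; [apply cos_nonneg with v; lra|].
  apply nodary_speed_nonneg; assumption.
Qed.

Lemma nodary_g_nonneg (a b s : R) : 0 < a -> 0 < b ->
  0 <= s <= PI / 2 -> 0 <= nodary_g a b s.
Proof.
  intros Ha Hb Hs; rewrite <- (nodary_g_0 a b).
  apply nodary_g_incr; lra.
Qed.

(** The derivative is twice the speed times g cos + f sin, and both of these terms are nonnegative
    on the range considered. *)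
Lemma nodary_norm_incr (a b u v : R) : 0 < a -> 0 < b ->
  0 <= u -> u <= v -> v <= PI / 2 ->
  nodary_g a b u ^ 2 + nodary_f a b u ^ 2 <=
  nodary_g a b v ^ 2 + nodary_f a b v ^ 2.
Proof.
  intros Ha Hb Hu Huv Hv.
  apply (is_derive_le (fun x => nodary_g a b x ^ 2 + nodary_f a b x ^ 2)
    (fun x => 2 * (nodary_g a b x * cos x + nodary_f a b x * sin x)
              * (a * nodary_f a b x / nodary_root a b x))); [exact Huv| |].
  - intros x Hx.
    pose proof (is_derive_nodary_g a b x Hb) as H1.
    pose proof (is_derive_nodary_f a b x Hb) as H2.
    auto_derive; [repeat split; eexists; eassumption|].
    rewrite Derive_nodary_g by exact Hb.
    rewrite Derive_nodary_f by exact Hb.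
    unfold Rdiv; ring.
  - intros x Hx.
    pose proof (nodary_g_nonneg a b x Ha Hb ltac:(lra)).
    pose proof (nodary_f_pos a b x Hb).
    pose proof (cos_nonneg x v ltac:(lra) Hv).
    pose proof (sin_nonneg x v ltac:(lra) Hv).
    apply Rmult_le_pos; [nra|apply nodary_speed_nonneg; assumption].
Qed.

(** * Dependence on the parameter b *)

Lemma nodary_root_incr (a b b' x : R) : 0 < b -> b <= b' ->
  nodary_root a b x <= nodary_root a b' x.
Proof.
  intros Hb Hbb; apply sqrt_le_1_alt; nra.
Qed.

(** Here (D' - D)(D' + D) = (b' - b)(b' + b), while D + D' >= b + b'. *)
Lemma nodary_root_lipschitz (a b b' x : R) : 0 < b -> b <= b' ->
  nodary_root a b' x - nodary_root a b x <= b' - b.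
Proof.
  intros Hb Hbb.
  assert (H : forall b, 0 < b -> b <= nodary_root a b x).
  { intros c Hc; rewrite <- (sqrt_pow2 c) at 1 by lra.
    apply sqrt_le_1_alt; nra. }
  pose proof (H b Hb); pose proof (H b' ltac:(lra)).
  pose proof (nodary_root_sqr a b x Hb).
  pose proof (nodary_root_sqr a b' x ltac:(lra)).
  apply (Rmult_le_reg_r (nodary_root a b' x + nodary_root a b x)); [lra|].
  nra.
Qed.

(* The difference of the two speeds is a^2 cos^2 (1/D - 1/D'), where
   D <= D' are the two values of [nodary_root]. *)
Lemma nodary_speed_diff (a b b' x : R) : 0 < b -> b <= b' ->
  0 <= a * cos x * nodary_f a b' x / nodary_root a b' x
       - a * cos x * nodary_f a b x / nodary_root a b x <= b' - b.
Proof.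
  intros Hb Hbb.
  pose proof (nodary_root_pos a b x Hb) as HD.
  pose proof (nodary_root_pos a b' x ltac:(lra)) as HD'.
  pose proof (nodary_root_incr a b b' x Hb Hbb) as Hi.
  pose proof (nodary_root_lipschitz a b b' x Hb Hbb) as Hl.
  pose proof (nodary_root_sqr a b x Hb) as HD2.
  change (nodary_f a b x) with (nodary_root a b x - a * cos x).
  change (nodary_f a b' x) with (nodary_root a b' x - a * cos x).
  set (D := nodary_root a b x) in *; set (D' := nodary_root a b' x) in *.
  replace (_ - _) with (a ^ 2 * cos x ^ 2 / (D * D') * (D' - D)) by (field; lra).
  (* The upper bound is a^2 cos^2 <= D^2 <= D D'. *)
  assert (Hq : 0 <= a ^ 2 * cos x ^ 2 / (D * D') <= 1).
  { split.
    - apply Rdiv_le_0_compat; [|nra].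
      rewrite <- Rpow_mult_distr; apply pow2_ge_0.
    - apply Rle_div_l; [nra|].
      assert (0 <= b ^ 2) by apply pow2_ge_0. nra. }
  nra.
Qed.

(** Both curves start at g = 0, so the bounds on the difference of the derivatives integrate from 0
    to s. The lower bound serves uniqueness, the upper one continuity. *)
Lemma nodary_g_diff (a b b' s : R) : 0 < b -> b <= b' -> 0 <= s ->
  0 <= nodary_g a b' s - nodary_g a b s <= (b' - b) * s.
Proof.
  intros Hb Hbb Hs.
  assert (Hb' : 0 < b') by lra.
  set (d := fun x => a * cos x * nodary_f a b' x / nodary_root a b' x
       - a * cos x * nodary_f a b x / nodary_root a b x).
  assert (Hd : forall x, is_derive (fun x => nodary_g a b' x - nodary_g a b x) x (d x)).
  { intros x; apply (is_derive_minus (K := R_AbsRing) (V := R_NormedModule));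
    apply is_derive_nodary_g; assumption. }
  split.
  - replace 0 with (nodary_g a b' 0 - nodary_g a b 0) by (rewrite !nodary_g_0; ring).
    apply (is_derive_le (fun x => nodary_g a b' x - nodary_g a b x) d);
      intros; auto; apply nodary_speed_diff; assumption.
  - enough (H : (b' - b) * 0 - (nodary_g a b' 0 - nodary_g a b 0)
      <= (b' - b) * s - (nodary_g a b' s - nodary_g a b s))
      by (rewrite !nodary_g_0 in H; lra).
    apply (is_derive_le (fun x => (b' - b) * x - (nodary_g a b' x - nodary_g a b x))
      (fun x => (b' - b) - d x)); [exact Hs| |].
    + intros x _; apply (is_derive_minus (K := R_AbsRing) (V := R_NormedModule)); [|apply Hd].
      auto_derive; [exact I|ring].
    + intros x _; pose proof (nodary_speed_diff a b b' x Hb Hbb).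
      unfold d; lra.
Qed.

(* Rationalising, f / b^2 = 1 / (D + a cos) with D = [nodary_root], so the
   derivative of g / b^2 is decreasing in b. *)
Lemma nodary_g_div_sqr_decr (a b b' s : R) : 0 < a -> 0 < b -> b <= b' ->
  0 <= s <= PI / 2 ->
  nodary_g a b' s / b' ^ 2 <= nodary_g a b s / b ^ 2.
Proof.
  intros Ha Hb Hbb Hs.
  assert (Hb' : 0 < b') by lra.
  assert (Hd : forall b x, 0 < b -> 0 <= cos x ->
    is_derive (fun x => nodary_g a b x / b ^ 2) x
      (a * cos x / (nodary_root a b x * (nodary_root a b x + a * cos x)))).
  { clear b b' Hb Hbb Hb'; intros b x Hb Hx.
    pose proof (nodary_root_pos a b x Hb) as HD.
    pose proof (nodary_root_sqr a b x Hb) as HD2.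
    pose proof (is_derive_nodary_g a b x Hb) as Hg.
    auto_derive; [eexists; eassumption|].
    rewrite Derive_nodary_g by exact Hb.
    change (nodary_f a b x) with (nodary_root a b x - a * cos x).
    set (D := nodary_root a b x) in *.
    replace (b * (b * 1)) with ((D - a * cos x) * (D + a * cos x)) by nra.
    assert (0 < D - a * cos x) by exact (nodary_f_pos a b x Hb).
    field; repeat split; nra. }
  enough (H : nodary_g a b 0 / b ^ 2 - nodary_g a b' 0 / b' ^ 2
    <= nodary_g a b s / b ^ 2 - nodary_g a b' s / b' ^ 2)
    by (rewrite !nodary_g_0 in H; unfold Rdiv in *; lra).
  apply (is_derive_le (fun x => nodary_g a b x / b ^ 2 - nodary_g a b' x / b' ^ 2)
    (fun x => a * cos x / (nodary_root a b x * (nodary_root a b x + a * cos x))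
      - a * cos x / (nodary_root a b' x * (nodary_root a b' x + a * cos x))));
    [apply Hs| |].
  - intros x Hx.
    apply (is_derive_minus (K := R_AbsRing) (V := R_NormedModule));
      apply Hd; try assumption; apply cos_nonneg with s; lra.
  - intros x Hx.
    pose proof (cos_nonneg x s Hx ltac:(lra)).
    pose proof (nodary_root_pos a b x Hb).
    pose proof (nodary_root_incr a b b' x Hb Hbb).
    apply Rge_le, Rge_minus, Rle_ge.
    assert (0 <= a * cos x) by nra.
    apply Rmult_le_compat_l; [assumption|].
    apply Rinv_le_contravar; nra.
Qed.

(** * Bounds on g for the intermediate value theorem *)

(** The mean value point lies strictly inside the interval, where cos > 0, so strictness holds even
    at s = PI / 2. *)
Lemma nodary_g_pos (a b s : R) : 0 < a -> 0 < b -> 0 < s <= PI / 2 ->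
  0 < nodary_g a b s.
Proof.
  intros Ha Hb Hs.
  destruct (MVT_cor2 (nodary_g a b)
    (fun x => a * cos x * nodary_f a b x / nodary_root a b x) 0 s)
    as [c [Hc Hcs]]; [lra| |].
  - intros x _; apply is_derive_Reals, is_derive_nodary_g, Hb.
  - rewrite nodary_g_0 in Hc.
    assert (0 < a * cos c * nodary_f a b c / nodary_root a b c).
    { apply Rdiv_lt_0_compat; [|apply nodary_root_pos, Hb].
      apply Rmult_lt_0_compat; [|apply nodary_f_pos, Hb].
      apply Rmult_lt_0_compat; [exact Ha|apply cos_gt_0; lra]. }
    nra.
Qed.

(** The difference a sin - g has derivative (a cos)^2 / D. The bound is uniform in b. *)
Lemma nodary_g_le_sin (a b s : R) : 0 < b -> 0 <= s ->
  nodary_g a b s <= a * sin s.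
Proof.
  intros Hb Hs.
  enough (H : a * sin 0 - nodary_g a b 0 <= a * sin s - nodary_g a b s)
    by (rewrite sin_0, nodary_g_0 in H; lra).
  apply (is_derive_le (fun x => a * sin x - nodary_g a b x)
    (fun x => (a * cos x) ^ 2 / nodary_root a b x)); [exact Hs| |].
  - intros x _.
    pose proof (is_derive_nodary_g a b x Hb) as Hg.
    pose proof (nodary_root_pos a b x Hb) as HD.
    auto_derive; [repeat split; eexists; eassumption|].
    rewrite Derive_nodary_g by exact Hb.
    change (nodary_f a b x) with (nodary_root a b x - a * cos x).
    field; lra.
  - intros x _; apply Rdiv_le_0_compat; [apply pow2_ge_0|].
    apply nodary_root_pos, Hb.
Qed.

(** * The parameter [nodary_b] and orthogonality *)

Lemma nodary_b_radicand_pos (a t : R) : 0 < a -> 0 < t <= PI / 2 ->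
  0 < sin t ^ 2 + 2 * a * sin t * cos t.
Proof.
  intros Ha Ht.
  assert (0 < sin t) by (apply sin_gt_0; generalize PI_RGT_0; lra).
  assert (0 <= cos t) by (apply cos_ge_0; lra).
  assert (0 <= a * sin t * cos t) by (repeat apply Rmult_le_pos; lra).
  nra.
Qed.

Lemma nodary_b_pos (a t : R) : 0 < a -> 0 < t <= PI / 2 -> 0 < nodary_b a t.
Proof. intros Ha Ht; apply sqrt_lt_R0, nodary_b_radicand_pos; assumption. Qed.

Lemma nodary_b_sqr (a t : R) : 0 < a -> 0 < t <= PI / 2 ->
  nodary_b a t ^ 2 = sin t ^ 2 + 2 * a * sin t * cos t.
Proof.
  intros Ha Ht; apply pow2_sqrt, Rlt_le, nodary_b_radicand_pos; assumption.
Qed.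

(** This explains the choice of b: it makes the radicand at t the perfect square (sin t + a cos
    t)^2. *)
Lemma nodary_f_b (a t : R) : 0 < a -> 0 < t <= PI / 2 ->
  nodary_f a (nodary_b a t) t = sin t.
Proof.
  intros Ha Ht.
  assert (0 < sin t) by (apply sin_gt_0; generalize PI_RGT_0; lra).
  assert (0 <= cos t) by (apply cos_ge_0; lra).
  unfold nodary_f; rewrite nodary_b_sqr by assumption.
  replace (_ + a ^ 2 * cos t ^ 2) with ((sin t + a * cos t) ^ 2) by ring.
  rewrite sqrt_pow2 by nra; ring.
Qed.

(** With f = sin t, the quantity g' f - g f' equals (a sin^2 t / D)(cos t - g), whose first factor
    is positive. Once g = cos t, the point lies on the circle. *)
Lemma nodary_orthogonal_iff (a t : R) : 0 < a -> 0 < t < PI / 2 ->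
  meets_unit_sphere_orthogonally
    (nodary_g a (nodary_b a t)) (nodary_f a (nodary_b a t)) t
  <-> nodary_g a (nodary_b a t) t = cos t.
Proof.
  intros Ha Ht.
  assert (Hs : 0 < sin t) by (apply sin_gt_0; generalize PI_RGT_0; lra).
  pose proof (nodary_b_pos a t Ha ltac:(lra)) as Hb.
  pose proof (nodary_root_pos a _ t Hb) as HD.
  unfold meets_unit_sphere_orthogonally.
  rewrite (is_derive_unique _ _ _ (is_derive_nodary_g a _ t Hb)).
  rewrite (is_derive_unique _ _ _ (is_derive_nodary_f a _ t Hb)).
  rewrite nodary_f_b by lra.
  set (g := nodary_g _ _ _); set (D := nodary_root _ _ _) in *.
  replace (_ * sin t - _) with (a * sin t ^ 2 / D * (cos t - g)) by (field; lra).
  assert (0 < a * sin t ^ 2 / D)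
    by (apply Rdiv_lt_0_compat; [apply Rmult_lt_0_compat; [|apply pow_lt]|]; assumption).
  split.
  - intros (_ & _ & H0).
    apply Rmult_integral in H0; lra.
  - intros ->; repeat split; [lra| |ring].
    rewrite <- !Rsqr_pow2, Rplus_comm; apply sin2_cos2.
Qed.

(** * Containment in the ball, and uniqueness of the crossing *)

Lemma nodary_inside (a t : R) : 0 < a -> 0 < t < PI / 2 ->
  nodary_g a (nodary_b a t) t = cos t ->
  inside_unit_ball_on
    (nodary_g a (nodary_b a t)) (nodary_f a (nodary_b a t)) (- t) t.
Proof.
  intros Ha Ht Hg.
  pose proof (nodary_b_pos a t Ha ltac:(lra)) as Hb.
  assert (H : forall s, 0 <= s <= t ->
    nodary_g a (nodary_b a t) s ^ 2 + nodary_f a (nodary_b a t) s ^ 2 <= 1).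
  { intros s Hs.
    replace 1 with (nodary_g a (nodary_b a t) t ^ 2 + nodary_f a (nodary_b a t) t ^ 2).
    - apply nodary_norm_incr; lra.
    - rewrite Hg, nodary_f_b by lra.
      rewrite <- !Rsqr_pow2, Rplus_comm; apply sin2_cos2. }
  intros s Hs.
  destruct (Rle_dec 0 s) as [Hs0|Hs0]; [apply H; lra|].
  rewrite <- (Ropp_involutive s), nodary_g_opp, nodary_f_opp by exact Hb.
  replace ((- _) ^ 2) with (nodary_g a (nodary_b a t) (- s) ^ 2) by ring.
  apply H; lra.
Qed.

(* If b increases from t to t' then so does g, whereas cos decreases; if it
   decreases then g / b^2 increases, whereas
   cos t / b(t)^2 = 1 / (sin t (tan t + 2 a)) decreases. *)
Lemma nodary_crossing_not_lt (a t t' : R) : 0 < a ->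
  0 < t -> t < t' -> t' < PI / 2 ->
  nodary_g a (nodary_b a t) t = cos t ->
  nodary_g a (nodary_b a t') t' = cos t' -> False.
Proof.
  intros Ha Ht Htt Ht' E E'.
  assert (Hc : cos t' < cos t) by (apply cos_decreasing_1; lra).
  assert (Hs : sin t < sin t') by (apply sin_increasing_1; lra).
  assert (0 < cos t') by (apply cos_gt_0; lra).
  assert (0 < sin t) by (apply sin_gt_0; lra).
  pose proof (nodary_b_pos a t Ha ltac:(lra)) as Hb.
  pose proof (nodary_b_pos a t' Ha ltac:(lra)) as Hb'.
  pose proof (nodary_g_incr a (nodary_b a t) t t' Ha Hb
    ltac:(lra) ltac:(lra) ltac:(lra)) as Hi.
  destruct (Rle_dec (nodary_b a t) (nodary_b a t')) as [Hbb|Hbb].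
  (* With b = b(t) and b' = b(t'), cos t = g(b, t) <= g(b, t') <= g(b', t') = cos t', a
     contradiction. *)
  - pose proof (nodary_g_diff a _ _ t' Hb Hbb ltac:(lra)); lra.
  - pose proof (nodary_g_div_sqr_decr a _ (nodary_b a t) t' Ha Hb'
      ltac:(lra) ltac:(lra)) as Hd.
    rewrite E' in Hd.
    assert (HB : 0 < nodary_b a t ^ 2) by (apply pow_lt, Hb).
    assert (HB' : 0 < nodary_b a t' ^ 2) by (apply pow_lt, Hb').
    (* The middle term is g(b(t), t') / b(t)^2: g first grows along the curve, then the parameter
       changes. *)
    assert (H1 : cos t / nodary_b a t ^ 2 <= cos t' / nodary_b a t' ^ 2).
    { eapply Rle_trans; [|exact Hd].
      apply Rmult_le_compat_r; [apply Rlt_le, Rinv_0_lt_compat, HB|lra]. }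
    apply (Rmult_le_compat_r (nodary_b a t ^ 2 * nodary_b a t' ^ 2)) in H1; [|nra].
    field_simplify in H1; [|lra|lra].
    rewrite !nodary_b_sqr in H1 by lra.
    (* Cross-multiplied, [H1] compares a sin^2 term and a term with factor 2 a cos t cos t'; each is
       strictly ordered the other way. *)
    assert (cos t' * sin t ^ 2 < cos t * sin t' ^ 2).
    { apply Rmult_le_0_lt_compat; nra. }
    assert (0 < a * cos t * cos t' * (sin t' - sin t))
      by (repeat apply Rmult_lt_0_compat; lra).
    nra.
Qed.

(** * Continuity and existence of the crossing *)

Lemma nodary_b_continuous (a t : R) : continuous (nodary_b a) t.
Proof.
  apply (continuous_comp (fun t => sin t ^ 2 + 2 * a * sin t * cos t) sqrt).
  - apply (ex_derive_continuous (V := R_NormedModule)); auto_derive; exact I.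
  (* The total [sqrt], zero on negative reals, is continuous on all of R. *)
  - apply continuous_sqrt.
Qed.

Lemma nodary_g_b_continuous (a t : R) : 0 < a -> 0 < t <= PI / 2 ->
  continuous (fun t => nodary_g a (nodary_b a t) t) t.
Proof.
  intros Ha Ht.
  pose proof (nodary_b_pos a t Ha Ht) as Hb.
  pose proof (nodary_b_continuous a t) as Hbc.
  (* An error bound vanishing at t: the Lipschitz estimate in b at fixed u, plus the variation in u
     at the fixed parameter b(t). *)
  set (e := fun u => Rabs (nodary_b a u - nodary_b a t) * u
    + Rabs (nodary_g a (nodary_b a t) u - nodary_g a (nodary_b a t) t)).
  assert (Hgc : continuous (nodary_g a (nodary_b a t)) t).
  { apply (ex_derive_continuous (V := R_NormedModule)).
    eexists; apply is_derive_nodary_g, Hb. }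
  assert (He : continuous e t).
  { apply (continuous_plus (V := R_NormedModule)).
    - apply (continuous_mult (K := R_AbsRing)); [|apply continuous_id].
      apply continuous_comp; [|apply continuous_Rabs].
      apply (continuous_minus (V := R_NormedModule)); [exact Hbc|apply continuous_const].
    - apply continuous_comp; [|apply continuous_Rabs].
      apply (continuous_minus (V := R_NormedModule)); [exact Hgc|apply continuous_const]. }
  assert (He0 : e t = 0).
  { unfold e; rewrite !Rminus_eq_0, Rabs_R0; ring. }
  apply filterlim_locally; intros eps.
  assert (H1 : locally t (fun u => Rabs (e u) < eps)).
  { generalize (proj1 (filterlim_locally _ _) He eps); rewrite He0.
    apply filter_imp; intros u Hu.
    change (Rabs (e u - 0) < eps) in Hu; rewrite Rminus_0_r in Hu; exact Hu. }
  assert (H2 : locally t (fun u => 0 < nodary_b a u))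
    by (apply Hbc, (open_gt 0), Hb).
  assert (H3 : locally t (fun u => 0 < u)) by (apply (open_gt 0); lra).
  generalize (filter_and _ _ H1 (filter_and _ _ H2 H3)).
  apply filter_imp; intros u (Hu & Hbu & Hu0).
  change (Rabs (nodary_g a (nodary_b a u) u - nodary_g a (nodary_b a t) t) < eps).
  apply Rle_lt_trans with (2 := Hu), Rle_trans with (2 := Rle_abs (e u)).
  unfold e.
  replace (nodary_g a (nodary_b a u) u - nodary_g a (nodary_b a t) t) with
    ((nodary_g a (nodary_b a u) u - nodary_g a (nodary_b a t) u)
     + (nodary_g a (nodary_b a t) u - nodary_g a (nodary_b a t) t)) by ring.
  eapply Rle_trans; [apply Rabs_triang|apply Rplus_le_compat_r].
  (* The Lipschitz estimate takes its two parameters in increasing order. *)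
  destruct (Rle_dec (nodary_b a t) (nodary_b a u)) as [Hle|Hle].
  - pose proof (nodary_g_diff a _ _ u Hb Hle ltac:(lra)).
    rewrite !Rabs_right; lra.
  - pose proof (nodary_g_diff a _ (nodary_b a t) u Hbu ltac:(lra) ltac:(lra)).
    rewrite !Rabs_left1; lra.
Qed.

Lemma nodary_crossing_exists (a : R) : 0 < a ->
  exists t, 0 < t < PI / 2 /\ nodary_g a (nodary_b a t) t = cos t.
Proof.
  intros Ha.
  (* As tan t1 = 1 / (2 a), a sin t1 = cos t1 / 2, so g - cos is negative at t1; starting at t1 > 0
     keeps b positive. *)
  set (t1 := atan (/ (2 * a))).
  assert (Ht1 : 0 < t1 < PI / 2).
  { split; [|apply atan_bound].
    rewrite <- atan_0; apply atan_increasing, Rinv_0_lt_compat; lra. }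
  assert (Hcos : 0 < cos t1) by (apply cos_gt_0; lra).
  assert (Hsin : a * sin t1 < cos t1).
  { assert (Htan : tan t1 = / (2 * a)) by apply tan_atan.
    replace (sin t1) with (tan t1 * cos t1) by (unfold tan; field; lra).
    rewrite Htan.
    replace (a * (/ (2 * a) * cos t1)) with (cos t1 / 2) by (field; lra).
    lra. }
  destruct (IVT_interv (fun t => nodary_g a (nodary_b a t) t - cos t) t1 (PI / 2))
    as [t [Ht E]].
  - intros t Ht.
    apply continuity_pt_minus; [|apply continuity_cos].
    apply continuity_pt_filterlim, nodary_g_b_continuous; lra.
  - lra.
  - pose proof (nodary_g_le_sin a _ t1 (nodary_b_pos a t1 Ha ltac:(lra)) ltac:(lra)).
    lra.
  - rewrite cos_PI2, Rminus_0_r.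
    apply nodary_g_pos; [exact Ha|apply nodary_b_pos; lra|lra].
  - exists t; split; [|lra].
    split; [lra|].
    (* The root comes from a closed interval; at its right end cos vanishes but g does not. *)
    destruct (Req_dec t (PI / 2)) as [->|]; [exfalso|lra].
    rewrite cos_PI2 in E.
    pose proof (nodary_g_pos a (nodary_b a (PI / 2)) (PI / 2) Ha
      (nodary_b_pos a (PI / 2) Ha ltac:(lra)) ltac:(lra)).
    lra.
Qed.

Theorem theorem4p18 :
  forall a : R, 0 < a ->
  exists! t0 : R,
    0 < t0 < PI / 2 /\
    let b := sqrt (sin t0 ^ 2 + 2 * a * sin t0 * cos t0) in
    inside_unit_ball_on (nodary_g a b) (nodary_f a b) (- t0) t0 /\
    meets_unit_sphere_orthogonally (nodary_g a b) (nodary_f a b) t0.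
Proof.
  intros a Ha.
  destruct (nodary_crossing_exists a Ha) as [t [Ht E]].
  exists t; split.
  - split; [exact Ht|split].
    + apply nodary_inside; assumption.
    + apply nodary_orthogonal_iff; assumption.
  - intros t' [Ht' [_ Ho]].
    apply nodary_orthogonal_iff in Ho; [|exact Ha|exact Ht'].
    destruct (Rtotal_order t t') as [H|[H|H]]; [|exact H|]; exfalso.
    + apply (nodary_crossing_not_lt a t t'); lra.
    + apply (nodary_crossing_not_lt a t' t); lra.
Qed.
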